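(* Let $F$ be a field of characteristic $p$, let $n$ be a positive integer, and let $V$ be the natural $S_n$-module over $F$. If $p=0$ or $p>n$, then for any positive integer $m$ we have \[ \operatorname{topdeg} F[V^{m}]_{S_n}=\binom{n}{2}. \]
   Context: $S_n$ is the symmetric group; the natural $S_n$-module $V$ is the $n$-dimensional $F$-vector space $F^n$ with $S_n$ permuting the standard basis (so $S_n$ acts on $F[V]=F[x_1,\dots,x_n]$ by permuting the variables), and $V^m$ is its $m$-fold direct sum. For a finite group $G$ and a finite-dimensional representation $W$ of $G$ over $F$, $F[W]=S(W^* )$ is the symmetric algebra on the dual space, graded by degree, on which $G$ acts by $\sigma(f)=f\circ\sigma^{-1}$. $F[W]^G$ is the ring of invariants and $F[W]^G_+$ is the set of invariants with zero constant term. The algebra of coinvariants is the finite-dimensional graded algebra $F[W]_G=F[W]/F[W]^G_+F[W]$, and its top degree $\operatorname{topdeg}F[W]_G$ is the largest degree in which $F[W]_G$ is non-zero. *)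

(* Defs.v *)
(* ClassicalEpsilon only serves to turn the Hilbert ideal into a boolean
   predicate, as the library's ring quotients require. *)
From Stdlib Require Import ClassicalEpsilon.
From HB Require Import structures.
From mathcomp Require Import all_boot all_order all_fingroup all_algebra.
From mathcomp Require Import mxrepresentation character.
From mathcomp.multinomials Require Import mpoly.

Set Implicit Arguments.
Unset Strict Implicit.
Unset Printing Implicit Defensive.

Import GRing.Theory.
Local Open Scope ring_scope.

Definition has_characteristic (F : fieldType) (p : nat) : Prop :=
  if p == 0%N then [pchar F] =i pred0 else p \in [pchar F].

Section Coinvariants.

Variables (F : fieldType) (gT : finGroupType) (G : {group gT}).
Variables (d : nat) (rG : mx_representation F G d).

(* W = 'rV[F]_d with g : G acting by v |-> v *m rG g, and F[W] = {mpoly F[d]},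
   'X_i being the coordinate function v |-> v 0 i.  Composing 'X_i with the
   action of g^-1 gives \sum_j rG g^-1 j i *: 'X_j, so that poly_act g f is
   the polynomial f \o g^-1. *)
Definition poly_act (g : gT) (f : {mpoly F[d]}) : {mpoly F[d]} :=
  f \mPo [tuple \sum_(j < d) rG g^-1%g j i *: 'X_j | i < d].

Definition invariant_poly (f : {mpoly F[d]}) : Prop :=
  forall g, g \in G -> poly_act g f = f.

Definition pos_invariant (f : {mpoly F[d]}) : Prop :=
  invariant_poly f /\ f@_0%MM = 0.

(* The ideal F[W]^G_+ F[W]. *)
Definition in_hilbert_ideal (f : {mpoly F[d]}) : Prop :=
  exists s : seq ({mpoly F[d]} * {mpoly F[d]}),
    (forall gh, gh \in s -> pos_invariant gh.1) /\
    f = \sum_(gh <- s) gh.1 * gh.2.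

Definition hilbert_ideal : {pred {mpoly F[d]}} :=
  fun f => if excluded_middle_informative (in_hilbert_ideal f)
           then true else false.

Lemma hilbert_idealP f : reflect (in_hilbert_ideal f) (f \in hilbert_ideal).
Proof.
rewrite /hilbert_ideal unfold_in.
by case: excluded_middle_informative => H; constructor.
Qed.

Lemma hilbert_ideal_closed : idealr_closed hilbert_ideal.
Proof.
split=> [||a u v /hilbert_idealP[s [sI ->]] /hilbert_idealP[t [tI ->]]].
- by apply/hilbert_idealP; exists [::]; rewrite big_nil.
- apply/hilbert_idealP => -[s [sI /(congr1 (mcoeff 0%MM))]].
  rewrite mcoeff1 eqxx raddf_sum /= big_seq big1 => [/eqP|gh /sI[_ gh0]].
    by rewrite oner_eq0.
  by have /= := rmorphM (mcoeff 0%MM) gh.1 gh.2; rewrite gh0 mul0r.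
apply/hilbert_idealP.
exists ([seq (gh.1, a * gh.2) | gh <- s] ++ t); split.
  move=> gh; rewrite mem_cat => /orP[/mapP[gh' gh's ->] | /tI //].
  exact: (sI gh').
rewrite big_cat big_map /= mulr_sumr; congr (_ + _).
by apply: eq_bigr => gh _; rewrite mulrCA.
Qed.

HB.instance Definition _ :=
  isIdealr.Build {mpoly F[d]} hilbert_ideal hilbert_ideal_closed.

Definition coinvariants := {ideal_quot hilbert_ideal}.

Definition in_coinv_degree (k : nat) (q : coinvariants) : Prop :=
  exists2 f : {mpoly F[d]}, f \is k.-homog & q = (\pi_coinvariants f)%qT.

Definition coinv_degree_nonzero (k : nat) : Prop :=
  exists2 q : coinvariants, in_coinv_degree k q & q <> 0.

Definition is_topdeg (k : nat) : Prop :=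
  coinv_degree_nonzero k /\ forall l, coinv_degree_nonzero l -> (l <= k)%N.

End Coinvariants.

Section NaturalModule.

Variables (F : fieldType) (n : nat).

Lemma perm_mx_repr : mx_repr [set: 'S_n] (@perm_mx F n).
Proof. by split=> [|s t _ _]; rewrite (perm_mx1, perm_mxM). Qed.

(* As 'e_i *m perm_mx s = 'e_(s i), this permutes the standard basis of F^n. *)
Definition natural_repr : representation F [set: 'S_n] :=
  Representation (MxRepresentation perm_mx_repr).

End NaturalModule.

(* Main.v *)
From HB Require Import structures.
Require Import Defs.
From mathcomp Require Import all_boot all_order all_fingroup all_algebra.
From mathcomp Require Import mxrepresentation character.
From mathcomp.multinomials Require Import mpoly.
From mathcomp Require Import ring.

(** Write the variables of F[V^m] as x_(i,a), where i is a basis vector of V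
(the block) and a is one of the m copies of V; a permutation s sends x_(i,a)
to x_(s i,a).  Let I be the Hilbert ideal.

Upper bound.  Number the blocks from 0 to n-1 and fix a copy a0.  The complete
homogeneous polynomial h_e in all the variables x_(i,a0) is invariant, so it
lies in I for e > 0.  The recursion
h_(e+1)(x_0..x_(k-1)) = h_(e+1)(x_0..x_k) - x_k h_e(x_0..x_k)
removes the variables one at a time, at the price of one degree each
([complete_sym_hilbert_ideal]): for every k < n, h_(n-k) in the variables of
blocks 0..k lies in I.  Give x_(i,a) the weight i.  In this h_(n-k) the
monomial x_(k,a0)^(n-k) has the largest weight, so modulo I it is a
combination of monomials of the same degree and smaller weight
([reducible_power]).  The polarization operators
sum_i x_(i,b) d/dx_(i,a0) commute with S_n, hence preserve I, and they preserve
degree and weight.  Applied repeatedly they turn x_(k,a0)^(n-k) into any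
monomial of degree n-k in the variables of block k, up to a factor which is a
product of positive integers not exceeding n, invertible under the assumption
on the characteristic.  So all these monomials can be lowered too
([reducible_block]).  A monomial of degree greater than
C(n,2) = sum_k (n-1-k) has, for some k, degree at least n-k in block k;
it can therefore be replaced modulo I by monomials of the same degree and
smaller weight, and induction on the weight puts it in I
([large_monomial_hilbert_ideal]).

Lower bound.  The monomial prod_i x_(i,a0)^i, of degree C(n,2), is not in I.
Indeed consider the coefficient of this monomial in the alternating sum
of the conjugates of f.  It is 1 when f is the monomial itself.  If f = g h
with g invariant without constant term, then the alternating sum is g times
that of h, and it only involves coefficients of the latter at proper divisors
of the monomial; such a divisor has the same exponent at two blocks, and an
alternating polynomial has coefficient 0 there
([staircase_notin_hilbert_ideal]). *)

Set Implicit Arguments.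
Unset Strict Implicit.
Unset Printing Implicit Defensive.

Import GRing.Theory.
Local Open Scope ring_scope.

(** * Complete homogeneous symmetric polynomials *)

Section CompleteSymmetric.

Variable R : comNzRingType.
Implicit Types (s t : seq R) (x y : R).

(** The complete homogeneous symmetric polynomials h_e of the entries of a list,
by the recursion h_(e+1)(x, s) = h_(e+1)(s) + x h_e(x, s): with it as the
definition, removing a variable is a computation, and the symmetry has to be
proved. *)
Fixpoint complete_sym s : nat -> R :=
  if s is x :: s' then
    fix h e := if e is e'.+1 then complete_sym s' e + x * h e' else 1
  else fun e => (e == 0)%:R.

Lemma complete_sym0 s : complete_sym s 0 = 1.
Proof. by case: s. Qed.

Lemma complete_sym_consS x s e :
  complete_sym (x :: s) e.+1 =
  complete_sym s e.+1 + x * complete_sym (x :: s) e.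
Proof. by []. Qed.

Lemma eq_complete_sym_cons x s t :
  complete_sym s =1 complete_sym t ->
  complete_sym (x :: s) =1 complete_sym (x :: t).
Proof.
by move=> st; elim=> [|e IHe] //; rewrite !complete_sym_consS st IHe.
Qed.

(** Unfolding the recursion at both x and y gives a linear recurrence of order
two in the degree, whose coefficients x + y and x * y are symmetric. *)
Lemma complete_sym_swap x y s :
  complete_sym (x :: y :: s) =1 complete_sym (y :: x :: s).
Proof.
have two_steps x' y' e : complete_sym (x' :: y' :: s) e.+2 =
  complete_sym s e.+2 + (x' + y') * complete_sym (x' :: y' :: s) e.+1
  - x' * y' * complete_sym (x' :: y' :: s) e.
  have tailE : complete_sym (y' :: s) e.+1 =
      complete_sym (x' :: y' :: s) e.+1 - x' * complete_sym (x' :: y' :: s) e.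
    by rewrite complete_sym_consS addrK.
  rewrite complete_sym_consS (complete_sym_consS y') tailE; ring.
move=> e; suff [] : complete_sym (x :: y :: s) e = complete_sym (y :: x :: s) e
  /\ complete_sym (x :: y :: s) e.+1 = complete_sym (y :: x :: s) e.+1 by [].
elim: e => [|e [IH0 IH1]]; last first.
  by split=> //; rewrite !two_steps IH0 IH1 (addrC x) (mulrC x).
by rewrite !complete_sym_consS !complete_sym0 !mulr1 -!addrA (addrC x).
Qed.

Lemma perm_complete_sym s t :
  perm_eq s t -> complete_sym s =1 complete_sym t.
Proof.
have extract x t1 t2 :
    complete_sym (t1 ++ x :: t2) =1 complete_sym (x :: t1 ++ t2).
  elim: t1 => [|y t1 IHt] e //.
  by rewrite !cat_cons (eq_complete_sym_cons y IHt) complete_sym_swap.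
elim: s t => [|x s IHs] t st.
  by have /perm_nilP-> : perm_eq t [::] by rewrite perm_sym.
have tx : x \in t by rewrite -(perm_mem st) mem_head.
case/splitPr: tx st => t1 t2.
rewrite perm_sym -cat1s perm_catCA perm_cons perm_sym => /IHs st e.
by rewrite (eq_complete_sym_cons x st) extract.
Qed.

End CompleteSymmetric.

Lemma complete_sym_map (R S : comNzRingType) (f : {rmorphism R -> S}) s e :
  complete_sym (map f s) e = f (complete_sym s e).
Proof.
elim: s e => [|x s IHs] e; first by rewrite /= rmorph_nat.
elim: e => [|e IHe]; first by rewrite /= rmorph1.
by rewrite map_cons !complete_sym_consS rmorphD rmorphM IHs -IHe.
Qed.

(** * Polynomials with monomials in a given set *)

Section SupportedPolynomials.

Variables (R : nzRingType) (d : nat).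
Implicit Types (P Q : pred 'X_{1..d}) (f g : {mpoly R[d]}).

Definition supported P f := {subset msupp f <= P}.

Lemma supported_sum P (I : eqType) (r : seq I) (A : pred I)
    (f : I -> {mpoly R[d]}) :
  (forall i, i \in r -> A i -> supported P (f i)) ->
  supported P (\sum_(i <- r | A i) f i).
Proof.
move=> fP; rewrite big_seq_cond; elim/big_rec: _ => [|i g /andP[ir Ai] gP] m.
  by rewrite msupp0.
by move/msuppD_le; rewrite mem_cat => /orP[/(fP i ir Ai)|/gP].
Qed.

Lemma supported0 P : supported P 0.
Proof. by move=> m; rewrite msupp0. Qed.

Lemma supportedD P f g : supported P f -> supported P g -> supported P (f + g).
Proof. by move=> fP gP m /msuppD_le; rewrite mem_cat => /orP[/fP|/gP]. Qed.

Lemma supportedZ P c f : supported P f -> supported P (c *: f).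
Proof. by move=> fP m /msuppZ_le/fP. Qed.

Lemma supportedX P m : P m -> supported P 'X_[m].
Proof. by move=> Pm m'; rewrite msuppX inE => /eqP->. Qed.

Lemma supportedW P Q f : {subset P <= Q} -> supported P f -> supported Q f.
Proof. by move=> PQ fP m /fP/PQ. Qed.

Lemma supported_linear P Q (D : {linear {mpoly R[d]} -> {mpoly R[d]}}) f :
  (forall m, P m -> supported Q (D 'X_[m])) -> supported P f ->
  supported Q (D f).
Proof.
move=> DQ fP; rewrite [f]mpolyE linear_sum; apply: supported_sum => m mf _.
by rewrite linearZ; apply/supportedZ/DQ/fP.
Qed.

Lemma supported_mulX P Q m f :
  (forall m', P m' -> Q (m + m')%MM) -> supported P f ->
  supported Q ('X_[m] * f).
Proof.
move=> PQ fP m' /msuppM_le/allpairsP[[m1 m2] /= [+ /fP/PQ m2Q ->]].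
by rewrite msuppX inE => /eqP->.
Qed.

End SupportedPolynomials.

(** * The Hilbert ideal *)

Section HilbertIdeal.

Variables (F : fieldType) (gT : finGroupType) (G : {group gT}) (d : nat).
Variable rG : mx_representation F G d.
Local Notation I := (hilbert_ideal rG).

Lemma hilbert_ideal_gen f : pos_invariant rG f -> f \in I.
Proof.
move=> f_inv; apply/hilbert_idealP; exists [:: (f, 1)].
by split=> [gh|]; rewrite ?big_seq1 ?mulr1 // inE => /eqP->.
Qed.

Lemma hilbert_idealZ c f : f \in I -> c *: f \in I.
Proof. by rewrite -mul_mpolyC; apply: idealMr. Qed.

Lemma hilbert_ideal_ind (P : {mpoly F[d]} -> Prop) :
  P 0 -> (forall f g, P f -> P g -> P (f + g)) ->
  (forall f g, pos_invariant rG f -> P (f * g)) -> forall f, f \in I -> P f.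
Proof.
move=> P0 PD PM f /hilbert_idealP[s [s_inv ->]].
by rewrite big_seq; elim/big_ind: _ => // gh /s_inv; apply: PM.
Qed.

(** This lets the rest of the argument deal with polynomials and membership in
the Hilbert ideal only. *)
Lemma coinv_degree_nonzeroP k :
  coinv_degree_nonzero rG k <->
  exists2 f : {mpoly F[d]}, f \is k.-homog & f \notin I.
Proof.
have pi0 f : (\pi_(coinvariants rG) f == 0)%qT = (f \in I).
  by rewrite -[f in RHS]subr0 Quotient.idealrBE !piE.
split=> [[q [f fk ->]] /eqP|[f fk fI]].
  by rewrite pi0; exists f.
by exists (\pi_(coinvariants rG) f)%qT; [exists f | apply/eqP; rewrite pi0].
Qed.

End HilbertIdeal.

(** * The action of the symmetric group on the variables *)

Section VectorInvariants.

(** V^m is abstracted into a permutation representation whose basis is indexed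
by pairs of a point of 'I_n and of a copy in a finite type C, S_n acting on the
first component.  The concrete indexing of an iterated direct sum only appears
in [muln_natural_repr_coords]. *)
Variables (F : fieldType) (n d : nat) (C : finType).
Variables (rG : mx_representation F [set: 'S_n] d).
Variables (pos : 'I_n * C -> 'I_d) (coord : 'I_d -> 'I_n * C).
Hypotheses (posK : cancel pos coord) (coordK : cancel coord pos).
Hypothesis rG_pos : forall g i a j,
  rG g (pos (i, a)) j = (j == pos (g i, a))%:R.

Implicit Types (s : 'S_n) (f g : {mpoly F[d]}) (m : 'X_{1..d}).

Local Notation block j := (coord j).1.
Local Notation "''x_' ( i , a )" := ('X_(pos (i, a)) : {mpoly F[d]})
  (at level 8, format "''x_' ( i ,  a )").
Local Notation I := (hilbert_ideal rG).

Definition var_act s (j : 'I_d) : 'I_d := pos (s (block j), (coord j).2).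

Lemma var_act_inj s : injective (var_act s).
Proof.
move=> j1 j2 /(can_inj posK)[/perm_inj b12 c12]; apply: (can_inj coordK).
by rewrite [LHS]surjective_pairing b12 c12 -surjective_pairing.
Qed.

Definition var_perm s : 'S_d := perm (@var_act_inj s).

Lemma var_perm_pos s i a : var_perm s (pos (i, a)) = pos (s i, a).
Proof. by rewrite permE /var_act posK. Qed.

Lemma var_permM s t : var_perm (s * t)%g = (var_perm s * var_perm t)%g.
Proof.
apply/permP=> j; rewrite -(coordK j); case: (coord j) => i a.
by rewrite permM !var_perm_pos permM.
Qed.

Lemma var_perm1 : var_perm 1%g = 1%g.
Proof. by apply: (mulgI (var_perm 1)); rewrite -var_permM !mulg1. Qed.

(** Substituting by permutation matrices permutes the variables, so that the
coefficients of the transformed polynomial are known. *)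
Lemma poly_actE s f : poly_act rG s f = msym (var_perm s) f.
Proof.
rewrite -[msym _ f]comp_mpoly_id msym_mPo /poly_act; congr (f \mPo _).
apply: eq_from_tnth => j; rewrite !tnth_mktuple -{1}(coordK j).
case Ej: (coord j) => [i a]; have {Ej}-> : j = pos (i, a) by rewrite -Ej coordK.
rewrite var_perm_pos (bigD1 (pos (s i, a))) //= rG_pos permK eqxx scale1r.
rewrite big1 ?addr0 // => k; rewrite -[k]coordK; case: (coord k) => i' a'.
rewrite rG_pos -[_ == pos (s i, a)](inj_eq (perm_inj (s := var_perm s^-1%g))).
by rewrite !var_perm_pos permK eq_sym => /negPf->; rewrite scale0r.
Qed.

Lemma pos_invariantP f :
  pos_invariant rG f <-> (forall s, msym (var_perm s) f = f) /\ f@_0%MM = 0.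
Proof.
split=> -[fG f0]; split=> // s; last by rewrite poly_actE fG.
by rewrite -poly_actE fG ?inE.
Qed.

(** * Polarization *)

Lemma msym_mderiv (t : 'S_d) j f : msym t f^`M(j) = (msym t f)^`M(t j).
Proof.
apply/mpolyP=> m; rewrite mcoeff_sym !mcoeff_deriv mcoeff_sym mnmE.
congr (f@_ _ *+ _); apply/mnmP=> k; rewrite !mnmE.
by rewrite (inj_eq perm_inj).
Qed.

Section Polarization.

Variables a0 b : C.

(** The derivation sending x_(i,a0) to x_(i,b) and killing the variables of the
copies other than a0; it changes copies but never blocks. *)
Definition polarize f : {mpoly F[d]} :=
  \sum_i 'x_(i, b) * f^`M(pos (i, a0)).

Lemma polarize_is_linear : linear polarize.
Proof.
move=> c f g; rewrite scaler_sumr -big_split; apply: eq_bigr => i _ /=.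
by rewrite linearP mulrDr -scalerAr.
Qed.

HB.instance Definition _ :=
  GRing.isLinear.Build F {mpoly F[d]} {mpoly F[d]} _ polarize
    polarize_is_linear.

Lemma polarizeM f g : polarize (f * g) = polarize f * g + f * polarize g.
Proof.
rewrite mulr_suml mulr_sumr -big_split; apply: eq_bigr => i _ /=.
rewrite mderivM; ring.
Qed.

Lemma msym_polarize s f :
  msym (var_perm s) (polarize f) = polarize (msym (var_perm s) f).
Proof.
rewrite raddf_sum [RHS](reindex_inj (@perm_inj _ s)); apply: eq_bigr => i _ /=.
rewrite msymM msym_mderiv var_perm_pos -(var_perm_pos s i b).
by rewrite /msym mmapX mmap1U.
Qed.

(** By Leibniz's rule it suffices that the derivation sends invariants to
invariants, which holds since it commutes with the group, and that its values
have no constant term. *)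
Lemma polarize_hilbert_ideal f : f \in I -> polarize f \in I.
Proof.
elim/hilbert_ideal_ind => {f} [|f g fI gI|f g f_inv].
- by rewrite linear0 rpred0.
- by rewrite linearD rpredD.
rewrite polarizeM rpredD // mulrC idealMr ?hilbert_ideal_gen //.
have /pos_invariantP[fG _] := f_inv.
apply/pos_invariantP; split=> [h|]; first by rewrite msym_polarize fG.
rewrite raddf_sum big1 //= => i _.
by rewrite (rmorphM (mcoeff 0%MM)) /= mcoeffX mnm1_eq0 mul0r.
Qed.

End Polarization.

(** * Leading powers modulo the Hilbert ideal *)

(** Induction on this weight makes the reductions modulo the Hilbert ideal
terminate; polarization preserves it because it ignores the copy. *)
Definition weight m : nat := (\sum_j m j * block j)%N.

Lemma weightD m1 m2 : weight (m1 + m2)%MM = (weight m1 + weight m2)%N.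
Proof.
by rewrite -big_split; apply: eq_bigr => j _ /=; rewrite mnmDE mulnDl.
Qed.

Lemma weightU i a : weight U_(pos (i, a))%MM = i.
Proof.
rewrite /weight (bigD1 (pos (i, a))) //= mnm1E eqxx mul1n posK big1 ?addn0 //.
by move=> j /negPf ne_j; rewrite mnm1E eq_sym ne_j.
Qed.

Lemma weight_exchange m i a b : (0 < m (pos (i, a)))%N ->
  let m' := (m - U_(pos (i, a)) + U_(pos (i, b)))%MM in
  mdeg m' = mdeg m /\ weight m' = weight m.
Proof.
move=> m_gt0 m'; have le_m : (U_(pos (i, a)) <= m)%MM.
  by apply/mnm_lepP=> j; rewrite mnm1E; case: eqP => // <-.
split; rewrite /m' -[in RHS](submK le_m); first by rewrite !mdegD !mdeg1.
by rewrite !weightD !weightU.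
Qed.

Definition lower e w : pred 'X_{1..d} :=
  [pred m | mdeg m == e & (weight m < w)%N].

(** Reducible monomials can be replaced modulo the Hilbert ideal by monomials of
the same degree and smaller weight. *)
Definition reducible m :=
  exists2 g, g \in I & supported (lower (mdeg m) (weight m)) ('X_[m] - g).

Section LeadingPower.

Variables (i0 : 'I_n) (a0 : C).

(** The variables of blocks k-1, ..., 0 in copy a0, the last block first so that
adding block k is a cons.  The default i0 is never reached for k <= n. *)
Definition copy_vars k : seq {mpoly F[d]} :=
  rev (mkseq (fun k => 'x_(insubd i0 k, a0)) k).

Lemma copy_varsS k : copy_vars k.+1 = 'x_(insubd i0 k, a0) :: copy_vars k.
Proof. by rewrite /copy_vars mkseqS rev_rcons. Qed.

(** A monomial of degree e in blocks 0..k-1 has weight at most (k-1)e; the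
inequality is written so as to make sense for k = 0 too. *)
Lemma supported_complete_sym k e : (k <= n)%N ->
  supported [pred m | mdeg m == e & (weight m + e <= k * e)%N]
    (complete_sym (copy_vars k) e).
Proof.
have weight0 : weight 0%MM = 0%N.
  by rewrite /weight big1 // => j _; rewrite mnm0E.
have supp1 k' :
    supported [pred m | mdeg m == 0%N & (weight m + 0 <= k' * 0)%N] 1.
  by rewrite -mpolyX0; apply: supportedX; rewrite /= mdeg0 weight0 muln0.
elim: k e => [|k IHk] e lt_kn.
  by case: e => [|e]; [apply: supp1 | apply: supported0].
rewrite copy_varsS; elim: e => [|e IHe]; first exact: supp1.
rewrite complete_sym_consS; apply: supportedD.
  apply: supportedW (IHk _ (ltnW lt_kn)) => m /andP[/= m_e m_w].
  apply/andP; split=> //=; apply: leq_trans m_w _.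
  by rewrite leq_mul2r leqnSn orbT.
apply: supported_mulX IHe => m /andP[/= /eqP m_e m_w]; apply/andP; split.
  by rewrite mdegD mdeg1 m_e.
rewrite weightD weightU insubdK // mulnS addSn addnS ltnS -addnA.
by rewrite leq_add2l.
Qed.

(** Among the monomials of degree e in blocks 0..k, only the e-th power of the
variable of block k reaches the weight k e. *)
Lemma lower_complete_sym_sub k e : (k < n)%N ->
  supported (lower e (k * e)%N)
    (complete_sym (copy_vars k.+1) e - 'x_(insubd i0 k, a0) ^+ e).
Proof.
move=> lt_kn; elim: e => [|e IHe].
  by rewrite complete_sym0 expr0 subrr; apply: supported0.
rewrite {1}copy_varsS complete_sym_consS -copy_varsS exprS -addrA -mulrBr.
apply: supportedD.
  apply: supportedW (supported_complete_sym (ltnW lt_kn)) => m.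
  case/andP=> /= m_e m_w.
  apply/andP; split=> //=; apply: leq_trans m_w.
  by rewrite addnS ltnS leq_addr.
apply: supported_mulX IHe => m /andP[/= /eqP m_e m_w]; apply/andP; split.
  by rewrite mdegD mdeg1 m_e.
by rewrite weightD weightU insubdK // mulnS ltn_add2l.
Qed.

(** Descending induction on k: for k = n the polynomial is a symmetric function
of all the variables of the copy; dropping the last variable expresses h_(e+1)
through h_(e+1) and h_e in one more variable. *)
Lemma complete_sym_hilbert_ideal k e :
  (k <= n)%N -> (n - k < e)%N -> complete_sym (copy_vars k) e \in I.
Proof.
move def_c: (n - k)%N => c.
elim: c k e def_c => [|c IHc] k [|e] // def_c le_kn lt_ce.
  have {def_c}-> : k = n by apply/eqP; rewrite eqn_leq le_kn -subn_eq0 def_c.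
  apply/hilbert_ideal_gen/pos_invariantP; split=> [s|]; last first.
    apply: memN_msupp_eq0; apply/negP.
    by case/(supported_complete_sym (leqnn n))/andP; rewrite mdeg0.
  rewrite -complete_sym_map; apply: perm_complete_sym.
  have -> : copy_vars n = rev [seq 'x_(i, a0) | i <- enum 'I_n].
    rewrite /copy_vars /mkseq -val_enum_ord -map_comp.
    by congr rev; apply: eq_map => i /=; rewrite valKd.
  have act_var : msym (var_perm s) \o (fun i => 'x_(i, a0))
      =1 (fun i => 'x_(i, a0)) \o s.
    by move=> i; rewrite /= /msym mmapX mmap1U var_perm_pos.
  rewrite map_rev perm_rev perm_sym perm_rev perm_sym -map_comp.
  rewrite (eq_map act_var) map_comp.
  apply: perm_map; apply: uniq_perm; rewrite ?enum_uniq //.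
    by rewrite map_inj_uniq ?enum_uniq //; apply: perm_inj.
  by move=> i; rewrite mem_enum -(permKV s i) map_f ?mem_enum.
have lt_kn : (k < n)%N by rewrite -subn_gt0 def_c.
have c_def : (n - k.+1)%N = c by rewrite subnS def_c.
have -> : complete_sym (copy_vars k) e.+1 =
    complete_sym (copy_vars k.+1) e.+1
    - 'x_(insubd i0 k, a0) * complete_sym (copy_vars k.+1) e.
  by rewrite copy_varsS complete_sym_consS addrK.
by rewrite rpredB ?idealMr ?IHc // ltnW.
Qed.

End LeadingPower.

Lemma reducible_power (k : 'I_n) a : reducible (U_(pos (k, a)) *+ (n - k))%MM.
Proof.
exists (complete_sym (copy_vars k a k.+1) (n - k)%N).
  by rewrite complete_sym_hilbert_ideal // ltn_sub2l.
rewrite -mpolyXn -opprB -scaleN1r; apply: supportedZ.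
have -> : mdeg (U_(pos (k, a)) *+ (n - k))%MM = (n - k)%N.
  by rewrite mdegMn mdeg1 mul1n.
have -> : weight (U_(pos (k, a)) *+ (n - k))%MM = (k * (n - k))%N.
  elim: (n - k)%N => [|e IHe].
    by rewrite muln0 /weight big1 // => j _; rewrite mulm0n mnm0E.
  by rewrite mulmS weightD weightU IHe mulnS.
have := @lower_complete_sym_sub k a k (n - k)%N (ltn_ord k).
by rewrite valKd.
Qed.

(** * The upper bound *)

Lemma polarizeX a0 b m :
  polarize a0 b 'X_[m] = \sum_i (m (pos (i, a0)))%:R *:
    'X_[m - U_(pos (i, a0)) + U_(pos (i, b))].
Proof.
apply: eq_bigr => i _.
by rewrite mderivX -scalerAr -mpolyXD addmC.
Qed.

Lemma supported_polarize a0 b e w f :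
  supported (lower e w) f -> supported (lower e w) (polarize a0 b f).
Proof.
apply: supported_linear => m /andP[/= m_e m_w].
rewrite polarizeX; apply: supported_sum => i _ _.
have [->|m_gt0] := posnP (m (pos (i, a0))).
  by rewrite scale0r; apply: supported0.
have [m'_e m'_w] := weight_exchange b m_gt0.
by apply/supportedZ/supportedX/andP; rewrite m'_e m'_w.
Qed.

(** Equivalently, the characteristic of F is 0 or greater than n. *)
Hypothesis small_unit : forall c, (0 < c <= n)%N -> c%:R != 0 :> F.

(** Induction on the number of variables of the monomial outside copy a0.  If m
involves x_(k,b) with b != a0, exchange one x_(k,b) for x_(k,a0); the resulting
monomial m1 is reducible by induction, and polarizing it from a0 to b gives
back m times the exponent of x_(k,a0) in m1.  This exponent lies between 1 and
the degree n - k, so it is invertible. *)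
Lemma reducible_block (a0 : C) (k : 'I_n) m :
  (forall j, block j != k -> m j = 0%N) -> mdeg m = (n - k)%N -> reducible m.
Proof.
have [c] := ubnP (n - k - m (pos (k, a0))).
elim: c m => // c IHc m lt_c m_k m_deg.
have [b /andP[ne_b m_b]|no_b] :=
  pickP [pred b | (b != a0) & 0 < m (pos (k, b))]%N; last first.
  suff -> : m = (U_(pos (k, a0)) *+ (n - k))%MM by apply: reducible_power.
  have m0 j : j != pos (k, a0) -> m j = 0%N.
    have [k_j|/m_k-> //] := eqVneq (block j) k.
    have j_pos : j = pos (k, (coord j).2).
      by rewrite -k_j -surjective_pairing coordK.
    apply: contraNeq => m_j; have := no_b (coord j).2.
    by rewrite /= -j_pos lt0n m_j andbT => /negbFE/eqP<-; rewrite -j_pos.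
  have m_a0 : m (pos (k, a0)) = (n - k)%N.
    by rewrite -m_deg mdegE (bigD1 (pos (k, a0))) //= big1 ?addn0.
  apply/mnmP=> j; rewrite mulmnE mnm1E -m_a0.
  by have [<-|ne_j] := eqVneq; rewrite ?mul1n // m0 // eq_sym.
set m1 := (m - U_(pos (k, b)) + U_(pos (k, a0)))%MM.
have [m1_deg m1_w] := weight_exchange a0 m_b.
have ne_pos : pos (k, b) != pos (k, a0).
  by rewrite (inj_eq (can_inj posK)) xpair_eqE eqxx.
have m1_a0 : m1 (pos (k, a0)) = (m (pos (k, a0))).+1.
  by rewrite mnmDE mnmBE !mnm1E eqxx (negPf ne_pos) subn0 addn1.
have lt_a0 : (m (pos (k, a0)) < n - k)%N.
  rewrite -m_deg mdegE (bigD1 (pos (k, a0))) //= (bigD1 (pos (k, b))) //=.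
  by rewrite -[ltnLHS]addn0 ltn_add2l ltn_addr.
have m1_k j : block j != k -> m1 j = 0%N.
  move=> ne_j; rewrite mnmDE mnmBE m_k // !mnm1E sub0n add0n.
  by case: (pos (k, a0) =P j) ne_j => // <-; rewrite posK eqxx.
have lt_m1 : (n - k - m1 (pos (k, a0)) < c)%N.
  by rewrite m1_a0 subnS prednK ?subn_gt0.
have [g gI m1_g] := IHc m1 lt_m1 m1_k (etrans m1_deg m_deg).
have DX : polarize a0 b 'X_[m1] = (m1 (pos (k, a0)))%:R *: 'X_[m].
  rewrite polarizeX (bigD1 k) //= big1 ?addr0 => [|i ne_i]; last first.
    by rewrite m1_k ?scale0r // posK.
  congr (_ *: 'X_[_]); rewrite addmK submK //; apply/mnm_lepP=> j.
  by rewrite mnm1E; case: eqP => // <-.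
have c_neq0 : (m1 (pos (k, a0)))%:R != 0 :> F.
  by rewrite small_unit // m1_a0 (leq_trans lt_a0) ?leq_subr.
exists ((m1 (pos (k, a0)))%:R^-1 *: polarize a0 b g).
  exact/hilbert_idealZ/polarize_hilbert_ideal.
have -> : 'X_[m] = (m1 (pos (k, a0)))%:R^-1 *: polarize a0 b 'X_[m1].
  by rewrite DX scalerA mulVf ?scale1r.
rewrite -scalerBr -linearB; apply/supportedZ/supported_polarize.
by rewrite m1_deg m1_w in m1_g.
Qed.

Definition block_part (k : 'I_n) m : 'X_{1..d} :=
  [multinom (if block j == k then m j else 0%N) | j < d].

Lemma sum_mdeg_block_part m : (\sum_k mdeg (block_part k m))%N = mdeg m.
Proof.
rewrite [RHS]mdegE (partition_big (fun j => block j) xpredT) //.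
apply: eq_bigr => k _; rewrite mdegE big_mkcond [RHS]big_mkcond /=.
by apply: eq_bigr => j _; rewrite mnmE.
Qed.

(** If every block k had degree at most n-1-k, the total degree would be at most
the sum of these bounds, which is C(n,2). *)
Lemma full_block m : ('C(n, 2) < mdeg m)%N ->
  exists k : 'I_n, (n - k <= mdeg (block_part k m))%N.
Proof.
move=> m_deg; apply/existsP; apply: contraLR m_deg => /existsPn small.
rewrite -leqNgt -bin2_sum big_mkord (reindex_inj rev_ord_inj).
rewrite -sum_mdeg_block_part.
apply: leq_sum => k _ /=; rewrite -ltnS -subSn //.
by rewrite subSS ltnNge small.
Qed.

Lemma submonomial m e : (e <= mdeg m)%N ->
  exists2 m', (m' <= m)%MM & mdeg m' = e.
Proof.
elim: e => [|e IHe] lt_e.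
  by exists 0%MM; [apply/mnm_lepP=> j; rewrite mnm0E | rewrite mdeg0].
have [m' le_m' m'_e] := IHe (ltnW lt_e).
have [j lt_j] : exists j, (m' j < m j)%N.
  apply/existsP; apply: contraLR lt_e => /existsPn ge_m.
  by rewrite -leqNgt -m'_e !mdegE leq_sum // => j _; rewrite leqNgt.
exists (m' + U_(j))%MM; last by rewrite mdegD mdeg1 m'_e addn1.
apply/mnm_lepP=> i; rewrite mnmDE mnm1E.
by case: eqP => [<-|_]; rewrite ?addn1 // addn0; apply/mnm_lepP.
Qed.

(** Induction on the weight: some block contains a reducible monomial, and
reducing it lowers the weight of m. *)
Lemma large_monomial_hilbert_ideal (a0 : C) m :
  ('C(n, 2) < mdeg m)%N -> 'X_[m] \in I.
Proof.
have [w] := ubnP (weight m); elim: w m => // w IHw m lt_w m_deg.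
have [k /submonomial[m2 m2_le m2_deg]] := full_block m_deg.
have m2_k j : block j != k -> m2 j = 0%N.
  move=> /negPf ne_j; have /mnm_lepP/(_ j) := m2_le.
  by rewrite mnmE ne_j leqn0 => /eqP.
have m2_m : (m2 <= m)%MM.
  apply: (lepm_trans m2_le); apply/mnm_lepP=> j; rewrite mnmE.
  by case: ifP.
have [g gI m2_g] := reducible_block a0 m2_k m2_deg.
rewrite -(submK m2_m) mpolyXD -[X in _ * X](subrK g) mulrDr.
rewrite rpredD //; last exact: idealMr.
have low : supported (lower (mdeg m) (weight m)) ('X_[m - m2] * ('X_[m2] - g)).
  apply: supported_mulX m2_g => m' /andP[/= /eqP m'_e m'_w].
  rewrite -[in mdeg m](submK m2_m) -[in weight m](submK m2_m).
  by apply/andP; rewrite /= !mdegD !weightD m'_e ltn_add2l.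
rewrite [_ * _]mpolyE big_seq rpred_sum // => m' /low/andP[/= /eqP m'_e m'_w].
by rewrite hilbert_idealZ // IHw ?m'_e // (leq_trans m'_w).
Qed.

Lemma large_degree_hilbert_ideal (a0 : C) l f :
  ('C(n, 2) < l)%N -> f \is l.-homog -> f \in I.
Proof.
move=> lt_l /dhomogP f_l; rewrite [f]mpolyE big_seq.
rewrite rpred_sum // => m /f_l /= m_l.
by rewrite hilbert_idealZ // large_monomial_hilbert_ideal // [mdeg _]m_l.
Qed.

(** * The lower bound *)

(** The exponents of the leading monomial of the Vandermonde determinant in copy
a0. *)
Definition staircase (a0 : C) : 'X_{1..d} :=
  [multinom (if (coord j).2 == a0 then block j : nat else 0%N) | j < d].

Lemma staircase_pos a0 i a :
  staircase a0 (pos (i, a)) = if a == a0 then i : nat else 0%N.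
Proof. by rewrite mnmE posK. Qed.

Lemma mdeg_staircase a0 : mdeg (staircase a0) = 'C(n, 2).
Proof.
rewrite -bin2_sum big_mkord mdegE (reindex pos) /=; last first.
  by exists coord => ? _; rewrite ?posK ?coordK.
transitivity (\sum_i \sum_a staircase a0 (pos (i, a)))%N.
  by rewrite pair_bigA; apply: eq_bigr => -[].
apply: eq_bigr => i _; rewrite (bigD1 a0) //= staircase_pos eqxx.
by rewrite big1 ?addn0 // => a ne_a; rewrite staircase_pos (negPf ne_a).
Qed.

Definition alternate f : {mpoly F[d]} :=
  \sum_(s : 'S_n) (-1) ^+ s *: msym (var_perm s) f.

Lemma msym_alternate (t : 'S_n) f :
  msym (var_perm t) (alternate f) = (-1) ^+ t *: alternate f.
Proof.
rewrite linear_sum scaler_sumr [RHS](reindex_inj (mulIg t)).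
apply: eq_bigr => s _ /=.
rewrite linearZ /= -msymMm -var_permM scalerA odd_permM; congr (_ *: _).
by rewrite signr_addb mulrCA -signr_addb addbb mulr1.
Qed.

Lemma alternate_invM f g : (forall s, msym (var_perm s) f = f) ->
  alternate (f * g) = f * alternate g.
Proof.
move=> fG; rewrite mulr_sumr; apply: eq_bigr => s _.
by rewrite msymM fG scalerAr.
Qed.

(** The transposition of i and j fixes the monomial m and negates the
alternating polynomial, so twice the coefficient vanishes; and 2 is invertible
since the existence of two distinct indices forces n > 1. *)
Lemma mcoeff_alternate_eq0 f m (i j : 'I_n) : i != j ->
  (forall a, m (pos (i, a)) = m (pos (j, a))) -> (alternate f)@_m = 0.
Proof.
move=> ne_ij m_ij; pose t := tperm i j.
have m_t : [multinom m (var_perm t k) | k < d] = m.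
  apply/mnmP=> k; rewrite mnmE -[k]coordK; case: (coord k) => k' a.
  by rewrite var_perm_pos permE /=; do 2?[case: eqP => [->|_] //].
have : (alternate f)@_m = - (alternate f)@_m.
  rewrite -{1}m_t -mcoeff_sym msym_alternate odd_tperm ne_ij expr1 scaleN1r.
  by rewrite mcoeffN.
move/eqP; rewrite -addr_eq0 -mulr2n -mulr_natl mulf_eq0 => /orP[|/eqP//].
suff n_gt1 : (1 < n)%N by rewrite (negPf (small_unit _)).
rewrite ltnNge; apply: contra ne_ij => le_n1; apply/eqP/val_inj.
have val0 (k : 'I_n) : k = 0%N :> nat.
  by apply/eqP; rewrite -leqn0 -ltnS (leq_trans (ltn_ord k)).
by rewrite /= !val0.
Qed.

(** Take the smallest i whose exponent v in m2 is less than i.  By minimality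
the exponent at v is v, so v and i have equal exponents; in the other copies all
exponents are 0. *)
Lemma staircase_proper_divisor a0 m1 m2 :
  staircase a0 = (m1 + m2)%MM -> m1 != 0%MM ->
  exists i j : 'I_n, i != j /\ forall a, m2 (pos (i, a)) = m2 (pos (j, a)).
Proof.
move=> m12 m1_neq0.
have le_m2 j : (m2 j <= staircase a0 j)%N by rewrite m12 mnmDE leq_addl.
have m2_0 i a : a != a0 -> m2 (pos (i, a)) = 0%N.
  move=> /negPf ne_a; apply/eqP; rewrite -leqn0.
  by have := le_m2 (pos (i, a)); rewrite staircase_pos ne_a.
have le_i i : (m2 (pos (i, a0)) <= i)%N.
  by have := le_m2 (pos (i, a0)); rewrite staircase_pos eqxx.
have [i1 lt_i1] : exists i : 'I_n, (m2 (pos (i, a0)) < i)%N.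
  apply/existsP; apply: contraR m1_neq0 => /existsPn ge_i.
  apply/eqP/(@addIm _ m2).
  rewrite -m12 add0m; apply/mnmP=> j.
  rewrite -[j]coordK; case: (coord j) => i a.
  rewrite staircase_pos; case: eqP => [->|/eqP/m2_0 //].
  by apply/eqP; rewrite eqn_leq le_i leqNgt ge_i.
have [i lt_i min_i] := @arg_minnP _ i1 (fun i => m2 (pos (i, a0)) < i)%N
  (@nat_of_ord n) lt_i1.
pose v := Ordinal (ltn_trans lt_i (ltn_ord i)).
have m2_v : m2 (pos (v, a0)) = v.
  apply/eqP; rewrite eqn_leq le_i leqNgt; apply/negP=> /min_i.
  by rewrite leqNgt lt_i.
exists v, i; split=> [|a]; first by rewrite neq_ltn lt_i.
by have [->|ne_a] := eqVneq a a0; [rewrite m2_v | rewrite !m2_0].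
Qed.

(** The linear form which takes the coefficient of the staircase monomial in the
alternating sum vanishes on the Hilbert ideal but not on that monomial. *)
Lemma staircase_notin_hilbert_ideal a0 : 'X_[staircase a0] \notin I.
Proof.
set delta := staircase a0.
have alt_delta f : f \in I -> (alternate f)@_delta = 0.
  elim/hilbert_ideal_ind => {f} [|f g f0 g0|f g /pos_invariantP[fG f0]].
  - rewrite /alternate big1 ?mcoeff0 // => s _.
    by rewrite msym0 scaler0.
  - rewrite /alternate; under eq_bigr do rewrite msymD scalerDr.
    by rewrite big_split mcoeffD [X in X + _]f0 [X in _ + X]g0 addr0.
  rewrite alternate_invM // mcoeffM big1 // => -[m1 m2] /= /eqP m12.
  have [m1_0|m1_neq0] := eqVneq (bmnm m1) 0%MM; first by rewrite m1_0 f0 mul0r.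
  have [i [j [ne_ij m2_ij]]] := staircase_proper_divisor m12 m1_neq0.
  by rewrite (mcoeff_alternate_eq0 _ ne_ij m2_ij) mulr0.
(* The staircase exponents are distinct, so only the identity contributes. *)
apply/negP=> /alt_delta/eqP.
rewrite raddf_sum (bigD1 1%g) //= big1 => [|s ne_s].
  rewrite odd_perm1 expr0 scale1r var_perm1 msym1m mcoeffX eqxx addr0.
  by rewrite oner_eq0.
rewrite mcoeffZ mcoeff_sym mcoeffX.
case: eqP => [fix_delta|_]; last by rewrite mulr0.
case/eqP: ne_s; apply/permP=> i; apply: val_inj; rewrite perm1 /=.
have /mnmP/(_ (pos (i, a0))) := fix_delta.
by rewrite mnmE var_perm_pos !staircase_pos eqxx.
Qed.

Lemma vector_invariants_topdeg (a0 : C) : is_topdeg rG 'C(n, 2).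
Proof.
split=> [|l /coinv_degree_nonzeroP[f f_l]].
  apply/coinv_degree_nonzeroP; exists 'X_[staircase a0].
    by rewrite dhomogX /= mdeg_staircase.
  exact: staircase_notin_hilbert_ideal.
rewrite leqNgt; apply: contra => lt_l.
exact: large_degree_hilbert_ideal lt_l f_l.
Qed.

End VectorInvariants.

(** * Coordinates on a multiple of the natural representation *)

(** Each further summand of the direct sum adds one copy, which is [None] in
[option C]. *)
Lemma muln_natural_repr_coords (F : fieldType) n m :
  let rG := muln_grepr (natural_repr F n) m in
  exists C : finType, #|C| = m /\
  exists (pos : 'I_n * C -> 'I_(rdegree rG))
         (coord : 'I_(rdegree rG) -> 'I_n * C),
  [/\ cancel pos coord, cancel coord pos &
      forall (s : 'S_n) i a j, rG s (pos (i, a)) j = (j == pos (s i, a))%:R].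
Proof.
rewrite /muln_grepr /=.
elim: m => [|m [C [C_m [pos [coord [posK coordK rG_pos]]]]]].
  rewrite big_ord0; exists void; split; first exact: card_void.
  exists (fun p : 'I_n * void => of_void _ p.2).
  exists (fun j : 'I_0 => False_rect _ (notF (ltn_ord j))).
  by split=> [[? []]|[]|? ? []].
rewrite big_ord_recl; move: (\big[_/_]_(i < m) _) pos coord posK coordK rG_pos.
move=> rG pos coord posK coordK rG_pos.
exists (option C); split; first by rewrite card_option C_m.
exists (fun p => if p.2 is Some a then rshift n (pos (p.1, a))
                 else lshift (rdegree rG) p.1).
exists (fun j => match split j with
                 | inl i => (i, None)
                 | inr k => ((coord k).1, Some (coord k).2)
                 end).
split=> [[i [a|]]|j|s i [a|] j] /=.
- by rewrite (unsplitK (inr _)) posK.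
- by rewrite (unsplitK (inl _)).
- case: (split_ordP j) => k ->; first by [].
  by rewrite /= -surjective_pairing coordK.
- case: (split_ordP j) => k ->; first by rewrite block_mxEdl mxE eq_lrshift.
  by rewrite block_mxEdr rG_pos eq_rshift.
case: (split_ordP j) => k ->.
  by rewrite block_mxEul !mxE eq_lshift eq_sym.
by rewrite block_mxEur mxE eq_rlshift.
Qed.

Theorem corollary14 (F : fieldType) (p n m : nat)
  (charF : has_characteristic F p) (n_gt0 : (0 < n)%N)
  (p_cond : p = 0%N \/ (n < p)%N) (m_gt0 : (0 < m)%N) :
  is_topdeg (muln_grepr (natural_repr F n) m) 'C(n, 2).
Proof.
have small_unit c : (0 < c <= n)%N -> c%:R != 0 :> F.
  case/andP=> c_gt0 le_cn; move: charF; rewrite /has_characteristic.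
  case: eqP => [_ /pcharf0P->|/eqP p_neq0 pF]; first by rewrite -lt0n.
  rewrite -(dvdn_pcharf pF) gtnNdvd //.
  by case: p_cond p_neq0 => [->//|lt_np _]; apply: leq_ltn_trans lt_np.
have [C [C_m [pos [coord [posK coordK rG_pos]]]]] :=
  muln_natural_repr_coords F n m.
have [a0 _] : exists a0 : C, a0 \in C by apply/card_gt0P; rewrite C_m.
exact: (vector_invariants_topdeg posK coordK rG_pos small_unit a0).
Qed.
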